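(* Let $(G,B,m,w)$ be a weighted finite graph with boundary. Then $\lambda_i\ge\mu_i$ for $i=1,2,\dots,|\Omega|$.
   Context: A weighted finite graph $(G,m,w)$ is a finite simple graph $G$ with vertex set $V$ and edge set $E$, a vertex-measure $m:V\to(0,\infty)$ and an edge-weight $w:E\to(0,\infty)$; $w$ is extended to a symmetric function on $V\times V$ by $w_{xy}=0$ when $\{x,y\}\notin E$. A weighted finite graph with boundary $(G,B,m,w)$ is a weighted finite graph with a nonempty subset $B\subset V$ (the boundary); $\Omega=V\setminus B$ is the interior. $\mathbb{R}^S$ is the space of real functions on $S$, with inner product $\langle u,v\rangle_S=\sum_{x\in S}u(x)v(x)m_x$. Laplacian: $\Delta u(x)=\frac1{m_x}\sum_{y\in V}(u(x)-u(y))w_{xy}$ for $u\in\mathbb{R}^V$; its eigenvalues, counted with multiplicity, are $0=\mu_1\le\mu_2\le\dots\le\mu_{|V|}$. Dirichlet Laplacian: for $u\in\mathbb{R}^\Omega$ let $E_0(u)\in\mathbb{R}^V$ be its extension by $0$ on $B$, and $\Delta^Du=(\Delta E_0(u))|_\Omega$. This is a nonnegative self-adjoint operator on $\mathbb{R}^\Omega$ with eigenvalues (the Dirichlet eigenvalues), counted with multiplicity, $0\le\lambda_1\le\dots\le\lambda_{|\Omega|}$. *)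

(* Defs.v *)
From HB Require Import structures.
From mathcomp Require Import all_boot all_order all_algebra.
From mathcomp Require Import reals polyrcf.

Set Implicit Arguments.
Unset Strict Implicit.
Unset Printing Implicit Defensive.

Import Order.TTheory GRing.Theory Num.Theory.
Local Open Scope ring_scope.

Record weighted_graph (R : realType) (V : finType) := WeightedGraph {
  adj : rel V;
  adj_sym : symmetric adj;
  adj_irr : irreflexive adj;
  vmeas : V -> R;
  vmeas_gt0 : forall x, 0 < vmeas x;
  weight : V -> V -> R;
  weight_sym : forall x y, weight x y = weight y x;
  weight_gt0 : forall x y, adj x y -> 0 < weight x y;
  weight_out : forall x y, ~~ adj x y -> weight x y = 0
}.

Section Laplacian.
Variables (R : realType) (V : finType) (G : weighted_graph R V).

Definition lap_fun (u : {ffun V -> R^o}) : {ffun V -> R^o} :=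
  [ffun x => (vmeas G x)^-1 * \sum_(y : V) (u x - u y) * weight G x y].

Fact lap_fun_is_linear : linear lap_fun.
Proof.
move=> a u v; apply/ffunP => x; rewrite !ffunE /=.
rewrite scalerAr -mulrDr; congr (_ * _).
rewrite scaler_sumr -big_split; apply: eq_bigr => y _ /=.
rewrite !ffunE scalerAl -mulrDl; congr (_ * _).
by rewrite scalerBr opprD addrACA.
Qed.

HB.instance Definition _ :=
  GRing.isLinear.Build R {ffun V -> R^o} {ffun V -> R^o} _ lap_fun
    lap_fun_is_linear.

Definition laplacian : 'End({ffun V -> R^o}) := linfun lap_fun.

Lemma laplacianE (u : {ffun V -> R^o}) (x : V) :
  laplacian u x =
  (vmeas G x)^-1 * \sum_(y : V) (u x - u y) * weight G x y.
Proof. by rewrite lfunE ffunE. Qed.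

End Laplacian.

Definition Omega (V : finType) (B : {set V}) : {set V} := ~: B.

Section DirichletLaplacian.
Variables (R : realType) (V : finType) (G : weighted_graph R V) (B : {set V}).

Definition ext0 (u : {ffun {x | x \in Omega B} -> R^o}) : {ffun V -> R^o} :=
  [ffun x => oapp u 0 (insub x)].

Definition dlap_fun (u : {ffun {x | x \in Omega B} -> R^o}) :
    {ffun {x | x \in Omega B} -> R^o} :=
  [ffun z => laplacian G (ext0 u) (val z)].

Fact dlap_fun_is_linear : linear dlap_fun.
Proof.
move=> a u v; apply/ffunP => z; rewrite !ffunE.
suff -> : ext0 (a *: u + v) = a *: ext0 u + ext0 v by rewrite linearP !ffunE.
apply/ffunP => x; rewrite !ffunE; case: insub => [y|] /=; first by rewrite !ffunE.
by rewrite scaler0 addr0.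
Qed.

HB.instance Definition _ :=
  GRing.isLinear.Build R {ffun {x | x \in Omega B} -> R^o}
    {ffun {x | x \in Omega B} -> R^o} _ dlap_fun dlap_fun_is_linear.

Definition dirichlet_laplacian : 'End({ffun {x | x \in Omega B} -> R^o}) :=
  linfun dlap_fun.

Lemma dirichlet_laplacianE u z :
  dirichlet_laplacian u z = laplacian G (ext0 u) (val z).
Proof. by rewrite lfunE ffunE. Qed.

End DirichletLaplacian.

(* The matrix of f in some basis only serves to enumerate the candidate       *)
(* eigenvalues: rootsR lists the distinct real roots in increasing order.     *)
Definition distinct_eigenvalues (R : realType) (vT : vectType R)
    (f : 'End(vT)) : seq R :=
  rootsR (char_poly (passmx.mxof (vbasis {:vT}) (vbasis {:vT}) f)).

(* Nondecreasing list of the real eigenvalues of f, each of them repeated as  *)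
(* many times as the dimension of its eigenspace.                             *)
Definition eigenvalues (R : realType) (vT : vectType R) (f : 'End(vT)) : seq R :=
  flatten [seq nseq (\dim (passmx.leigenspace f a)) a
          | a <- distinct_eigenvalues f].

Section EigenvaluesTheory.
Variables (R : realType) (vT : vectType R) (f : 'End(vT)).

Lemma mem_distinct_eigenvalues (a : R) :
  (a \in distinct_eigenvalues f) = passmx.leigenvalue f a.
Proof.
set M := passmx.mxof (vbasis {:vT}) (vbasis {:vT}) f.
have p0 : char_poly M != 0 by rewrite monic_neq0 ?char_poly_monic.
have := roots_on_rootsR p0 a; rewrite inE /= => <-.
rewrite -eigenvalue_root_char /passmx.leigenvalue.
by rewrite (passmx.leigenspaceE (vbasisP {:vT})) passmx.vsof_eq0 ?vbasisP.
Qed.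

Lemma count_eigenvalues (a : R) :
  count_mem a (eigenvalues f) = \dim (passmx.leigenspace f a).
Proof.
rewrite /eigenvalues count_flatten -map_comp.
rewrite (eq_map (g := fun b =>
  (b == a) * \dim (passmx.leigenspace f b)))%N; last first.
  by move=> b /=; rewrite count_nseq.
have [aE|aNE] := boolP (a \in distinct_eigenvalues f).
  have := aE; rewrite sumnE big_map => /(bigD1_seq a)-> /=; last first.
    exact/(sorted_uniq lt_trans ltxx)/sorted_roots.
  by rewrite eqxx mul1n big1 ?addn0 // => b /negPf->.
rewrite sumnE big_map big_seq big1 => [|b bE].
  apply/esym/eqP; rewrite dimv_eq0; apply/negPn.
  by rewrite -/(passmx.leigenvalue f a) -mem_distinct_eigenvalues.
by case: eqP bE aNE => // -> ->.
Qed.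

Lemma sorted_eigenvalues : sorted <=%R (eigenvalues f).
Proof.
rewrite /eigenvalues.
have : sorted <%R (distinct_eigenvalues f) by exact: sorted_roots.
rewrite !sorted_pairwise; [| exact: le_trans | exact: lt_trans].
elim: (distinct_eigenvalues f) => //= b s IHs /andP[bs /IHs {}IHs].
rewrite pairwise_cat IHs andbT; apply/andP; split.
  apply/allrelP => x y; rewrite mem_nseq => /andP[_ /eqP->].
  move=> /flatten_mapP[c cs]; rewrite mem_nseq => /andP[_ /eqP->].
  exact/ltW/(allP bs).
by elim: (\dim _) => //= n ->; rewrite andbT; apply/allP => y;
  rewrite mem_nseq => /andP[_ /eqP->].
Qed.

End EigenvaluesTheory.

(* Main.v *)
Require Import Defs.
From HB Require Import structures.
From mathcomp Require Import all_boot all_order all_algebra.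
From mathcomp Require Import reals.
From mathcomp Require Import polyrcf complex ring.
Import Order.TTheory GRing.Theory Num.Theory.
Import passmx.
Local Open Scope ring_scope.

Set Implicit Arguments.
Unset Strict Implicit.
Unset Printing Implicit Defensive.

(* Extension by zero is an isometry E_0 : R^Omega -> R^V for the weighted *)
(* inner products, and <Lap^D u, u> = <Lap (E_0 u), E_0 u>, so Lap^D is a *)
(* compression of Lap. If lambda_i < mu_i, then E_0 maps the span of the *)
(* Dirichlet eigenspaces for eigenvalues <= lambda_i (dimension >= i) to a *)
(* space that meets the span of the eigenspaces of Lap for eigenvalues >= mu_i *)
(* (dimension >= |V| - i + 1) in some v <> 0, whose Rayleigh quotient is both *)
(* <= lambda_i and >= mu_i. The dimension counts need the spectral theorem: *)
(* the orthogonal complement of the sum of the eigenspaces is stable, so it *)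
(* would contain an eigenvector if it were nonzero. *)

(** The inequality is one half of Cauchy interlacing: compressing a self-adjoint operator to a
    subspace cannot lower its [i]-th smallest eigenvalue. [le_eigenvalues_compression] proves it for
    an abstract isometry [j], with indices starting at 0. The Rayleigh bounds are [dot_eigensum_le]
    and [dot_eigensum_ge]; [dim_eigensum_filter] and the two counting lemmas on sorted lists turn
    positions into dimensions. Since [eigenvalues] repeats each value by the dimension of its
    eigenspace, [spectral_theorem] is what makes the list complete. The graph enters through Green's
    formula ([laplacian_selfadjoint]) and the adjunction between restriction and extension by zero
    ([wdot_ext0]). *)

(* x + i y is an eigenvector of the complexification of f, for a + i b. *)
Lemma exists_complex_eigenpair (R : rcfType) (vT : vectType R) (f : 'End(vT)) :
    {:vT}%VS != 0%VS ->
  exists a b x y, [/\ (x != 0) || (y != 0), f x = a *: x - b *: y &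
    f y = b *: x + a *: y].
Proof.
rewrite -dimv_eq0 -lt0n => dim_gt0.
pose e := vbasis {:vT}; pose M := mxof e e f.
pose MC := map_mx (real_complex R) M.
have [z] : exists z, eigenvalue MC z by exact: eigenvalue_closed.
move=> /eigenvalueP[v vM v0].
have vMj j : \sum_k v 0 k * (M k j)%:C%C = z * v 0 j.
  have /(congr1 (fun w : 'rV_ _ => w 0 j)) := vM.
  by rewrite !mxE => <-; apply: eq_bigr => k _; rewrite !mxE.
pose x := map_mx (@complex.Re R) v; pose y := map_mx (@complex.Im R) v.
(* The entries of [M] are real, so taking real or imaginary parts commutes with multiplication by
   [M]. *)
have xM : x *m M = complex.Re z *: x - complex.Im z *: y.
  apply/rowP => j; rewrite !mxE.
  have /(congr1 (@complex.Re R)) := vMj j.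
  case: (z) (v 0 j) => [p q] [r s] /= <-.
  elim/big_rec2: _ => [|k u1 u2 _ ->] //.
  rewrite /x mxE; case: (v 0 k) => r' s' /=.
  by rewrite raddfD /= mulr0 subr0.
have yM : y *m M = complex.Im z *: x + complex.Re z *: y.
  apply/rowP => j; rewrite !mxE.
  have /(congr1 (@complex.Im R)) := vMj j.
  case: (z) (v 0 j) => [p q] [r s] /=; rewrite addrC => <-.
  elim/big_rec2: _ => [|k u1 u2 _ ->] //.
  rewrite /y mxE; case: (v 0 k) => r' s' /=.
  by rewrite raddfD /= mulr0 add0r.
exists (complex.Re z), (complex.Im z), (vecof e x), (vecof e y).
have ee := vbasisP {:vT}.
rewrite !(vecof_eq0 ee) !(hom_vecof e ee) xM yM linearB linearD /= !linearZ /=.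
split=> //; apply: contraNT v0; rewrite negb_or !negbK.
move=> /andP[/eqP x0 /eqP y0].
apply/eqP/rowP => j; rewrite [RHS]mxE.
move/rowP: x0 => /(_ j); move/rowP: y0 => /(_ j); rewrite !mxE.
by case: (v 0 j) => r s /= -> ->.
Qed.

(** Stability makes the restriction of [f] an endomorphism [g] of the space [subvs_of U], to which
    the previous lemma applies. *)
Lemma exists_stable_complex_eigenpair (R : rcfType) (vT : vectType R)
    (f : 'End(vT)) (U : {vspace vT}) :
    (f @: U <= U)%VS -> U != 0%VS ->
  exists a b x y, [/\ x \in U /\ y \in U, (x != 0) || (y != 0),
    f x = a *: x - b *: y & f y = b *: x + a *: y].
Proof.
move=> fU U0.
pose g : 'End(subvs_of U) := (linfun (vsproj U) \o f \o linfun vsval)%VF.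
have gE u : vsval (g u) = f (vsval u).
  rewrite !comp_lfunE !lfunE /= vsprojK //.
  by apply: (subvP fU); rewrite memv_img ?subvsP.
have [|a [b [x [y [xy gx gy]]]]] := exists_complex_eigenpair g.
  by rewrite -dimv_eq0 dimvf /dim /= dimv_eq0.
exists a, b, (vsval x), (vsval y); split; rewrite ?subvsP //.
- by rewrite -gE gx.
- by rewrite -gE gy.
Qed.

(** * Spectral theory of self-adjoint endomorphisms *)

Section SelfAdjoint.
Variables (R : realType) (vT : vectType R) (dot : {biscalar vT}).
Hypothesis dotC : forall u v, dot u v = dot v u.
Hypothesis dot_gt0 : forall u : vT, u != 0 -> 0 < dot u u.
Variable f : 'End(vT).
Hypothesis f_sa : forall u v, dot (f u) v = dot u (f v).

Let dot_ge0 u : 0 <= dot u u.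
Proof. by have [->|/dot_gt0/ltW] := eqVneq u 0; rewrite ?linear0l. Qed.

Lemma leigenspaceP a u : reflect (f u = a *: u) (u \in leigenspace f a).
Proof.
rewrite memv_ker add_lfunE opp_lfunE scale_lfunE id_lfunE subr_eq0.
exact: eqP.
Qed.

(** Self-adjointness forces the complex eigenvalue to be real; then whichever of its real and
    imaginary parts [x], [y] is nonzero is an eigenvector. *)
Lemma exists_stable_eigenvector (U : {vspace vT}) :
    (f @: U <= U)%VS -> U != 0%VS ->
  exists a u, [/\ u \in U, u != 0 & u \in leigenspace f a].
Proof.
move=> fU U0.
have [a [b [x [y [[xU yU] xy fx fy]]]]] :=
  exists_stable_complex_eigenpair fU U0.
have b0 : b = 0.
  (* Compare <f x, y> with <x, f y>. *)
  have : b * (dot x x + dot y y) = 0.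
    have := f_sa x y; rewrite fx fy.
    rewrite linearBl linearDr /= !linearZl_LR !linearZr_LR /=.
    move=> /eqP; rewrite -subr_eq0 => /eqP h.
    by rewrite -[RHS]oppr0 -[in RHS]h; ring.
  move=> /eqP; rewrite mulf_eq0 => /orP[/eqP//|].
  rewrite paddr_eq0 // => /andP[/eqP dx /eqP dy].
  by case/orP: xy => /dot_gt0; rewrite ?dx ?dy ltxx.
move: fx fy; rewrite b0 !scale0r subr0 add0r => fx fy.
by case/orP: xy => [x0|y0]; [exists a, x|exists a, y]; split=> //;
  apply/leigenspaceP.
Qed.

Lemma dot_leigenspace a b u v :
  u \in leigenspace f a -> v \in leigenspace f b -> a != b -> dot u v = 0.
Proof.
move=> /leigenspaceP fu /leigenspaceP fv ab; have := f_sa u v.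
rewrite fu fv linearZl_LR linearZr_LR /= => /eqP.
by rewrite -subr_eq0 -mulrBl mulf_eq0 subr_eq0 (negPf ab) => /eqP.
Qed.

Definition eigensum (s : seq R) := (\sum_(a <- s) leigenspace f a)%VS.

Lemma mem_eigensum s a : a \in s -> (leigenspace f a <= eigensum s)%VS.
Proof.
elim: s => //= b s IHs; rewrite /eigensum big_cons inE => /orP[/eqP->|/IHs].
  exact: addvSl.
by move=> h; apply: subv_trans h _; exact: addvSr.
Qed.

Lemma dot_eigensum s a u v :
  a \notin s -> u \in leigenspace f a -> v \in eigensum s -> dot u v = 0.
Proof.
move=> + ua; elim: s v => [|b s IHs] v.
  by rewrite /eigensum big_nil memv0 => _ /eqP->; rewrite linear0r.
rewrite inE negb_or => /andP[ab as_]; rewrite /eigensum big_cons.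
move=> /memv_addP[x xb [y ys ->]].
by rewrite linearDr /= (dot_leigenspace ua xb ab) (IHs _ as_ ys) addr0.
Qed.

(** The sum is direct: a vector common to one eigenspace and the sum of the others is orthogonal to
    itself. *)
Lemma dim_eigensum s : uniq s ->
  \dim (eigensum s) = (\sum_(a <- s) \dim (leigenspace f a))%N.
Proof.
elim: s => [|a s IHs] /=; first by rewrite /eigensum !big_nil dimv0.
move=> /andP[as_ /IHs {}IHs].
rewrite {1}/eigensum !big_cons dimv_disjoint_sum ?IHs //.
apply/eqP; rewrite -subv0; apply/subvP => u; rewrite memv_cap memv0.
move=> /andP[ua us]; apply: contraTT isT => /dot_gt0.
by rewrite (dot_eigensum as_ ua us) ltxx.
Qed.

(* The weights are the squared norms of the spectral components of u. *)
Lemma spectral_weights s u : uniq s -> u \in eigensum s ->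
  exists w : R -> R, [/\ forall a, 0 <= w a, dot u u = \sum_(a <- s) w a &
    dot (f u) u = \sum_(a <- s) a * w a].
Proof.
elim: s u => [|a s IHs] u /=.
  rewrite /eigensum big_nil memv0 => _ /eqP->; exists (fun=> 0).
  by split=> [_||]; rewrite ?big_nil ?linear0r.
move=> /andP[as_ us]; rewrite /eigensum big_cons.
move=> /memv_addP[x xa [y ys ->]].
have [w [w_ge0 yE fyE]] := IHs y us ys.
have xy : dot x y = 0 := dot_eigensum as_ xa ys.
have /leigenspaceP fx := xa.
have fyx : dot (f y) x = 0 by rewrite f_sa fx linearZr_LR /= dotC xy mulr0.
(* Since [a] is not in [s], giving it the weight of [x] leaves the sums over [s] unchanged. *)
exists (fun b => if b == a then dot x x else w b).
have eqs (g : R -> R -> R) :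
    \sum_(b <- s) g b (if b == a then dot x x else w b) =
    \sum_(b <- s) g b (w b).
  rewrite !big_seq; apply: eq_bigr => b bs.
  by case: eqP bs as_ => // -> ->.
split.
- by move=> b; case: ifP.
- rewrite big_cons eqxx (eqs (fun _ w => w)) -yE.
  by rewrite linearDl !linearDr /= xy (dotC y x) xy addr0 add0r.
- rewrite big_cons eqxx (eqs *%R) -fyE [f (x + y)]linearD.
  by rewrite linearDl !linearDr /= fyx fx !linearZl_LR /= xy mulr0 addr0 add0r.
Qed.

(** By [spectral_weights], the Rayleigh quotient of a nonzero [u] is a weighted mean of elements of
    [s]. *)
Lemma dot_eigensum_le s t u : uniq s -> {in s, forall a, a <= t} ->
  u \in eigensum s -> dot (f u) u <= t * dot u u.
Proof.
move=> us st /(spectral_weights us)[w [w0 -> ->]].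
by rewrite mulr_sumr !big_seq; apply: ler_sum => a /st at_; rewrite ler_wpM2r.
Qed.

Lemma dot_eigensum_ge s t u : uniq s -> {in s, forall a, t <= a} ->
  u \in eigensum s -> t * dot u u <= dot (f u) u.
Proof.
move=> us st /(spectral_weights us)[w [w0 -> ->]].
by rewrite mulr_sumr !big_seq; apply: ler_sum => a /st at_; rewrite ler_wpM2r.
Qed.

Lemma uniq_distinct_eigenvalues : uniq (distinct_eigenvalues f).
Proof. exact/(sorted_uniq lt_trans ltxx)/sorted_roots. Qed.

Lemma eigensum_stable s u : u \in eigensum s -> f u \in eigensum s.
Proof.
elim: s u => [|a s IHs] u; rewrite /eigensum.
  by rewrite big_nil !memv0 => /eqP->; rewrite linear0.
rewrite big_cons => /memv_addP[x xa [y /IHs ys ->]].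
rewrite linearD /= memv_add //.
by have /leigenspaceP-> := xa; apply: memvZ.
Qed.

Theorem spectral_theorem : eigensum (distinct_eigenvalues f) = {:vT}%VS.
Proof.
set W := eigensum _.
(* The orthogonal complement [U] of [W] is encoded as the kernel of the pairing with a basis of
   [W]. *)
pose h (u : vT) : 'rV[R]_(\dim W) := \row_j dot u (vbasis W)`_j.
have h_lin : linear h by move=> c u v; apply/rowP => j; rewrite !mxE linearPl.
pose hM := GRing.isLinear.Build R vT 'rV[R]_(\dim W) *:%R h h_lin.
pose hL : {linear vT -> 'rV[R]_(\dim W)} := HB.pack h hM.
pose U := lker (linfun hL).
have memU u : reflect {in W, forall v, dot u v = 0} (u \in U).
  rewrite memv_ker lfunE; apply: (iffP eqP) => [/rowP hu v vW|hu].
    rewrite (coord_vbasis vW) linear_sumr big1 // => j _.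
    have := hu j; rewrite !mxE linearZr_LR /= => ->.
    by rewrite mulr0.
  by apply/rowP => j; rewrite !mxE hu // vbasis_mem ?mem_nth ?size_tuple.
have U0 : U = 0%VS.
  apply/eqP/negPn/negP => U0.
  have fU : (f @: U <= U)%VS.
    apply/subvP => _ /memv_imgP[u /memU uU ->].
    by apply/memU => v vW; rewrite f_sa uU ?eigensum_stable.
  have [a [u [/memU uU u0 ua]]] := exists_stable_eigenvector fU U0.
  (* The eigenvector [u] of [U] also lies in [W], so it would be orthogonal to itself. *)
  have aE : a \in distinct_eigenvalues f.
    rewrite mem_distinct_eigenvalues; apply: contraNneq u0 => a0.
    by rewrite a0 memv0 in ua.
  have := dot_gt0 u0; rewrite uU ?ltxx //.
  exact: (subvP (mem_eigensum aE)).
(* As [h] has trivial kernel and takes values in rows of length [\dim W], the whole space has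
   dimension at most [\dim W]. *)
apply/eqP; rewrite eqEdim subvf /=.
rewrite -(limg_ker_dim (linfun hL) {:vT}) capfv -/U U0 dimv0 add0n.
by rewrite (leq_trans (dimvS (subvf _))) // dimvf /dim /= mul1n.
Qed.

Lemma dim_eigensum_filter (P : pred R) :
  \dim (eigensum (filter P (distinct_eigenvalues f))) = count P (eigenvalues f).
Proof.
rewrite dim_eigensum ?filter_uniq ?uniq_distinct_eigenvalues // big_filter.
rewrite /eigenvalues count_flatten -map_comp sumnE big_map big_mkcond.
by apply: eq_bigr => a _ /=; rewrite count_nseq; case: (P a); rewrite ?mul1n.
Qed.

(** Guarantees that an index below the dimension reads a true eigenvalue, not the default 0 of
    [nth]. *)
Lemma size_eigenvalues : size (eigenvalues f) = \dim {:vT}.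
Proof.
by rewrite -spectral_theorem -count_predT -dim_eigensum_filter filter_predT.
Qed.

End SelfAdjoint.

(** * Comparison of the eigenvalues of an operator and of its compression *)

Lemma count_le_sorted_nth (R : realType) (s : seq R) (i : nat) :
  sorted <=%R s -> (i < size s)%N -> (i < count (<= s`_i)%R s)%N.
Proof.
move=> s_sorted i_s; rewrite -[X in count _ X](cat_take_drop i.+1 s) count_cat.
have -> : count (<= s`_i)%R (take i.+1 s) = i.+1.
  rewrite -[RHS](size_takel i_s); apply/eqP; rewrite -all_count.
  apply/(all_nthP 0) => k; rewrite size_takel // ltnS => ki.
  rewrite nth_take //= (sorted_leq_nth le_trans le_refl) // inE.
  exact: leq_ltn_trans ki _.
exact: leq_addr.
Qed.

Lemma count_ge_sorted_nth (R : realType) (s : seq R) (i : nat) :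
  sorted <=%R s -> (size s - i <= count (>= s`_i)%R s)%N.
Proof.
move=> s_sorted; rewrite -[X in count _ X](cat_take_drop i s) count_cat.
have -> : count (>= s`_i)%R (drop i s) = (size s - i)%N.
  rewrite -size_drop; apply/eqP; rewrite -all_count.
  apply/(all_nthP 0) => k; rewrite size_drop ltn_subRL => ki.
  rewrite nth_drop /= (sorted_leq_nth le_trans le_refl) ?leq_addr // inE //.
  by apply: leq_ltn_trans ki; exact: leq_addr.
exact: leq_addl.
Qed.

(** The hypotheses on [j] say that [g] has the quadratic form of [f] pulled back along an isometry,
    so Rayleigh quotients of [g] at [u] and of [f] at [j u] agree. *)
Theorem le_eigenvalues_compression (R : realType) (vT wT : vectType R)
    (dotv : {biscalar vT}) (dotw : {biscalar wT})
    (f : 'End(vT)) (g : 'End(wT)) (j : 'Hom(wT, vT)) (i : nat) :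
    (forall u v, dotv u v = dotv v u) ->
    (forall u : vT, u != 0 -> 0 < dotv u u) ->
    (forall u v, dotv (f u) v = dotv u (f v)) ->
    (forall u v, dotw u v = dotw v u) ->
    (forall u : wT, u != 0 -> 0 < dotw u u) ->
    (forall u v, dotw (g u) v = dotw u (g v)) ->
    (forall u, dotv (j u) (j u) = dotw u u) ->
    (forall u, dotv (f (j u)) (j u) = dotw (g u) u) ->
    (i < \dim {:wT})%N ->
  (eigenvalues f)`_i <= (eigenvalues g)`_i.
Proof.
move=> dvC dv_gt0 f_sa dwC dw_gt0 g_sa j_iso j_comp i_lt.
rewrite leNgt; apply/negP => lt_gf.
set t := (eigenvalues g)`_i in lt_gf; set m := (eigenvalues f)`_i in lt_gf.
pose U := eigensum g (filter (<= t) (distinct_eigenvalues g)).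
pose W := eigensum f (filter (>= m) (distinct_eigenvalues f)).
have dimU : (i < \dim U)%N.
  rewrite (dim_eigensum_filter dw_gt0 g_sa) count_le_sorted_nth //.
    exact: sorted_eigenvalues.
  by rewrite (size_eigenvalues dw_gt0 g_sa).
have dimW : (\dim {:vT} - i <= \dim W)%N.
  rewrite (dim_eigensum_filter dv_gt0 f_sa) -(size_eigenvalues dv_gt0 f_sa).
  exact/count_ge_sorted_nth/sorted_eigenvalues.
have j_inj : lker j == 0%VS.
  rewrite -subv0; apply/subvP => u; rewrite memv_ker memv0 => /eqP ju.
  by apply: contraTT isT => /dw_gt0; rewrite -j_iso ju linear0r ltxx.
have dimjU : \dim (j @: U) = \dim U by rewrite limg_dim_eq // (eqP j_inj) capv0.
(* The dimensions add up to at least (i + 1) + (n - i) > n, where n is the dimension of [vT]. *)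
have : ((j @: U) :&: W)%VS != 0%VS.
  rewrite -dimv_eq0 -lt0n -(ltn_add2l (\dim (j @: U + W))) addn0.
  rewrite dimv_sum_cap dimjU (leq_ltn_trans (dimvS (subvf _))) //.
  apply: leq_trans (leq_add dimU dimW).
  by rewrite addSn ltnS -leq_subLR.
rewrite -vpick0; set v := vpick _ => v0.
have := memv_pick ((j @: U) :&: W)%VS; rewrite -/v memv_cap => /andP[].
move=> /memv_imgP[u uU vE] vW.
have fle : dotv (f v) v <= t * dotv v v.
  rewrite vE j_comp j_iso; apply: (dot_eigensum_le dwC dw_gt0 g_sa _ _ uU).
    by rewrite filter_uniq ?uniq_distinct_eigenvalues.
  by move=> a; rewrite mem_filter => /andP[].
have fge : m * dotv v v <= dotv (f v) v.
  apply: (dot_eigensum_ge dvC dv_gt0 f_sa _ _ vW).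
    by rewrite filter_uniq ?uniq_distinct_eigenvalues.
  by move=> a; rewrite mem_filter => /andP[].
have := le_trans fge fle.
by rewrite ler_pM2r ?dv_gt0 // leNgt lt_gf.
Qed.

(** * Weighted inner products on function spaces *)

Section WeightedDot.
Variables (R : realType) (T : finType) (m : T -> R).
Implicit Types u v : {ffun T -> R^o}.

Definition wdot u v : R := \sum_x u x * v x * m x.

Fact wdot_is_bilinear : bilinear_for *%R *%R wdot.
Proof.
split=> [w|w] c u v; rewrite /wdot /= mulr_sumr -big_split;
  apply: eq_bigr => x _; rewrite !ffunE /= /GRing.scale /=; ring.
Qed.

HB.instance Definition _ := bilinear_isBilinear.Build R {ffun T -> R^o}
  {ffun T -> R^o} R *%R *%R wdot wdot_is_bilinear.

Lemma wdotC u v : wdot u v = wdot v u.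
Proof. by apply: eq_bigr => x _; rewrite [u x * _]mulrC. Qed.

Lemma wdot_gt0 u : (forall x, 0 < m x) -> u != 0 -> 0 < wdot u u.
Proof.
move=> m_gt0 u0.
have term_ge0 x : 0 <= u x * u x * m x.
  by rewrite mulr_ge0 ?(ltW (m_gt0 x)) // -expr2 sqr_ge0.
rewrite lt0r sumr_ge0 ?andbT //; apply: contraNneq u0.
move=> /eqP; rewrite psumr_eq0 // => /allP u0; apply/eqP/ffunP => x.
rewrite ffunE; have := u0 x; rewrite mem_index_enum => /(_ isT) /=.
by rewrite mulf_eq0 (gt_eqF (m_gt0 x)) orbF mulf_eq0 orbb => /eqP.
Qed.

End WeightedDot.

(** * The graph Laplacian and its Dirichlet compression *)

Section GraphLaplacians.
Variables (R : realType) (V : finType) (G : weighted_graph R V) (B : {set V}).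
Local Notation wdotV := (wdot (vmeas G)).
Local Notation wdotO := (wdot (fun z : {x | x \in Omega B} => vmeas G (val z))).

(** Green's formula [dirichlet] rewrites the pairing as the Dirichlet energy, which is symmetric in
    its two arguments. *)
Lemma laplacian_selfadjoint u v :
  wdotV (laplacian G u) v = wdotV u (laplacian G v).
Proof.
have dirichlet u' v' : wdotV (laplacian G u') v' =
    2^-1 * \sum_x \sum_y (u' x - u' y) * (v' x - v' y) * weight G x y.
  have E1 : wdotV (laplacian G u') v' =
      \sum_x \sum_y (u' x - u' y) * v' x * weight G x y.
    apply: eq_bigr => x _; rewrite laplacianE mulrAC [_^-1 * _]mulrC.
    rewrite mulfVK ?gt_eqF ?vmeas_gt0 // mulr_suml.
    by apply: eq_bigr => y _; rewrite mulrAC.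
  (* Exchanging [x] and [y] flips the sign of the difference; adding [E1] and [E2] then produces
     twice the pairing, whence the factor 1/2. *)
  have E2 : wdotV (laplacian G u') v' =
      \sum_x \sum_y - ((u' x - u' y) * v' y * weight G x y).
    rewrite E1 exchange_big; apply: eq_bigr => x _; apply: eq_bigr => y _ /=.
    rewrite weight_sym; ring.
  apply: (mulfI (x := 2)); first by rewrite pnatr_eq0.
  rewrite mulVKf ?pnatr_eq0 // mulr_natl mulr2n {1}E1 E2 -big_split.
  apply: eq_bigr => x _; rewrite -big_split; apply: eq_bigr => y _ /=; ring.
rewrite [RHS]wdotC !dirichlet; congr (_ * _).
by apply: eq_bigr => x _; apply: eq_bigr => y _; rewrite [_ * (v x - _)]mulrC.
Qed.

Lemma ext0_out (u : {ffun {x | x \in Omega B} -> R^o}) x :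
  x \notin Omega B -> ext0 u x = 0.
Proof. by move=> xO; rewrite ffunE insubN. Qed.

Lemma ext0_val (u : {ffun {x | x \in Omega B} -> R^o}) z : ext0 u (val z) = u z.
Proof. by rewrite ffunE valK. Qed.

(** Restriction to the interior is adjoint to [ext0], because [ext0 v] vanishes on the boundary.
    This yields both the isometry and the compression property of [ext0]. *)
Lemma wdot_ext0 u v : wdotV u (ext0 v) = wdotO [ffun z => u (val z)] v.
Proof.
rewrite /wdot (bigID (mem (Omega B))) /= [X in _ + X]big1 ?addr0; last first.
  by move=> x /ext0_out->; rewrite mulr0 mul0r.
rewrite (big_sub).
by apply: eq_bigr => z _; rewrite ext0_val ffunE.
Qed.

Lemma dirichlet_wdot u v :
  wdotO (dirichlet_laplacian G B u) v = wdotV (laplacian G (ext0 u)) (ext0 v).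
Proof.
rewrite wdot_ext0; congr (wdotO _ v); apply/ffunP => z.
by rewrite dirichlet_laplacianE ffunE.
Qed.

Lemma dirichlet_selfadjoint u v :
  wdotO (dirichlet_laplacian G B u) v = wdotO u (dirichlet_laplacian G B v).
Proof.
rewrite [RHS]wdotC (dirichlet_wdot u v) (dirichlet_wdot v u).
by rewrite laplacian_selfadjoint wdotC.
Qed.

Fact ext0_is_linear : linear (@ext0 R V B).
Proof.
move=> c u v; apply/ffunP => x; rewrite !ffunE.
by case: insub => [z|] /=; rewrite ?ffunE ?scaler0 ?addr0.
Qed.

HB.instance Definition _ :=
  GRing.isLinear.Build R {ffun {x | x \in Omega B} -> R^o} {ffun V -> R^o} _
    (@ext0 R V B) ext0_is_linear.

End GraphLaplacians.

Theorem corollary1p3 (R : realType) (V : finType) (G : weighted_graph R V)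
    (B : {set V}) (hB : B != set0) (i : nat) (hi : (i < #|Omega B|)%N) :
  (eigenvalues (laplacian G))`_i <= (eigenvalues (dirichlet_laplacian G B))`_i.
Proof.
pose dotV := wdot (vmeas G).
pose dotO := wdot (fun z : {x | x \in Omega B} => vmeas G (val z)).
apply: (@le_eigenvalues_compression _ _ _ dotV dotO _ _ (linfun (@ext0 R V B))).
- exact: wdotC.
- by move=> u; apply/wdot_gt0/vmeas_gt0.
- exact: laplacian_selfadjoint.
- exact: wdotC.
- by move=> u; apply: wdot_gt0 => z; exact: vmeas_gt0.
- exact: dirichlet_selfadjoint.
- move=> u; rewrite lfunE /= /dotV wdot_ext0; congr (dotO _ u).
  by apply/ffunP => z; rewrite ffunE ext0_val.
- by move=> u; rewrite [linfun _ u]lfunE; exact/esym/dirichlet_wdot.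
- by rewrite dimvf /dim /= card_sig muln1.
Qed.
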